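(* For any integer $r\ge 2$, $$\chi_l(K_{(r+1)*r}^r)>\chi(K_{(r+1)*r}^r)=r.$$
   Context: All hypergraphs are finite. A vertex coloring of a hypergraph is proper if no edge is monochromatic. $\chi(H)$ is the chromatic number. A $k$-list assignment $L$ assigns to each vertex $v$ a set $L(v)$ of exactly $k$ colors; an $L$-coloring is a proper coloring with each vertex $v$ colored from $L(v)$; $\chi_l(H)$ is the least $k$ such that $H$ is $L$-colorable for every $k$-list assignment $L$. For positive integers $p_1,\dots,p_k$ and disjoint sets $V_1,\dots,V_k$ with $|V_i|=p_i$, the hypergraph $K^r_{p_1,\dots,p_k}$ has vertex set $V_1\cup\cdots\cup V_k$ and edge set consisting of all $r$-subsets $S$ of the vertex set with $S\not\subseteq V_i$ for every $i$. $K^r_{(r+1)*r}$ denotes this hypergraph with $r$ parts, each of size $r+1$. *)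

(* Defs.v *)
From mathcomp Require Import all_boot finmap boolp.

Set Implicit Arguments.
Unset Strict Implicit.
Unset Printing Implicit Defensive.

Definition hypergraph (T : finType) : Type := {set {set T}}.

Definition monochromatic (T : finType) (C : Type) (c : T -> C) (e : {set T})
  : Prop := forall u v, u \in e -> v \in e -> c u = c v.

Definition proper_coloring (T : finType) (H : hypergraph T) (C : Type)
  (c : T -> C) : Prop := forall e, e \in H -> ~ monochromatic c e.

Definition colorable (T : finType) (H : hypergraph T) (k : nat) : Prop :=
  exists c : T -> 'I_k, proper_coloring H c.

Definition list_assignment (T : finType) (C : choiceType) (k : nat)
  (L : T -> {fset C}) : Prop := forall v, #|` L v| = k.

Definition list_colorable (T : finType) (H : hypergraph T) (C : choiceType)
  (L : T -> {fset C}) : Prop :=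
  exists c : T -> C, (forall v, c v \in L v) /\ proper_coloring H c.

Definition choosable (T : finType) (H : hypergraph T) (k : nat) : Prop :=
  forall (C : choiceType) (L : T -> {fset C}),
    list_assignment k L -> list_colorable H L.

(* The value is 0 when no natural number satisfies [P]; for the two chromatic
   numbers below this happens when some edge has at most one vertex. *)
Definition least (P : nat -> Prop) : nat :=
  if pselect (exists n, `[< P n >]) is left exP then ex_minn exP else 0.

Definition chromatic_number (T : finType) (H : hypergraph T) : nat :=
  least (colorable H).

Definition list_chromatic_number (T : finType) (H : hypergraph T) : nat :=
  least (choosable H).

(* The vertex [Tagged _ j] with tag [i] is the [j]-th element of the part
   V_i. *)
Definition vertex (k : nat) (p : 'I_k -> nat) : finType :=
  {i : 'I_k & 'I_(p i)}.

Definition part (k : nat) (p : 'I_k -> nat) (i : 'I_k) : {set vertex p} :=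
  [set v | tag v == i].

Definition complete_multipartite (r k : nat) (p : 'I_k -> nat)
  : hypergraph (vertex p) :=
  [set S : {set vertex p} |
    (#|S| == r) && [forall i, ~~ (S \subset part p i)]].

(* The hypergraph K^r_{m*k}, with [k] parts of size [m]. *)
Definition balanced_multipartite (r m k : nat) :=
  complete_multipartite r (fun _ : 'I_k => m).

(* Main.v *)
(* In a proper coloring of [K^r_{p_1,...,p_k}] a color class with at least [r]
   vertices lies inside one part.  Hence [r - 1] colors cover at most
   [(r - 1) * (r + 1)] of the [r * (r + 1)] vertices of [K^r_{(r+1)*r}].
   For the list chromatic number, give the [j]-th vertex of every part the list
   of the [r + 1] colors with color [j] removed.  A class of color [x] avoids
   one vertex of each part, so it has at most [r] vertices; since the [r + 1]
   classes cover [r * (r + 1)] vertices, each has exactly [r] vertices and lies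
   in one part.  So every part, of size [r + 1], is a disjoint union of sets of
   size [r], which is impossible. *)
Require Import Defs.
From mathcomp Require Import all_boot finmap boolp.

Set Implicit Arguments.
Unset Strict Implicit.
Unset Printing Implicit Defensive.

Lemma leastP (P : nat -> Prop) : (exists n, P n) -> P (least P).
Proof.
move=> [n Pn]; rewrite /least; case: pselect => [exP|[]]; last first.
  by exists n; apply/asboolP.
by case: ex_minnP => m /asboolP.
Qed.

Lemma least_leq (P : nat -> Prop) n : P n -> least P <= n.
Proof.
move=> Pn; rewrite /least; case: pselect => [exP|//].
by case: ex_minnP => m _; apply; apply/asboolP.
Qed.

Lemma exists_subset_between (T : finType) (A B : {set T}) n :
  A \subset B -> #|A| <= n <= #|B| ->
  exists2 S : {set T}, A \subset S & (S \subset B) && (#|S| == n).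
Proof.
move=> AB; elim: n => [|n IHn] /andP[leAn lenB].
  by exists A; rewrite // AB -leqn0.
move: leAn; rewrite leq_eqVlt => /orP[eqAn|ltAn].
  by exists A; rewrite // AB.
have [|S AS /andP[SB /eqP Sn]] := IHn; first by rewrite -ltnS ltAn ltnW.
have /properP[_ [x xB xS]] : S \proper B by rewrite properEcard SB Sn.
exists (x |: S); first exact: subset_trans AS (subsetUr _ _).
by rewrite subUset sub1set xB SB cardsU1 xS Sn /=.
Qed.

(** Two vertices of the class in different parts could be extended inside the class to an [r]-set,
    which would be a monochromatic edge. Since [1 < r], the pair itself is not too large. *)
Lemma color_class_sub_part (C : eqType) (r k : nat) (p : 'I_k -> nat)
    (c : vertex p -> C) (x : C) :
  1 < r -> proper_coloring (complete_multipartite r p) c ->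
  r <= #|[set v | c v == x]| ->
  exists i, [set v | c v == x] \subset part p i.
Proof.
set S := [set _ | _] => r_gt1 propc leS.
have /card_gt0P[u uS] : 0 < #|S| by apply: leq_trans leS; apply: ltnW.
exists (tag u); apply/negPn/negP => /subsetPn[w wS]; rewrite inE => neq_wu.
have uwS : [set u; w] \subset S by rewrite subUset !sub1set uS.
have leuw : #|[set u; w]| <= r <= #|S|.
  by rewrite leS andbT cards2; case: (_ != _) => //; apply: ltnW.
have [B uwB /andP[BS Br]] := exists_subset_between uwS leuw.
move: uwB; rewrite subUset !sub1set => /andP[uB wB].
apply: (propc B) => [|a b /(subsetP BS) + /(subsetP BS)]; last first.
  by rewrite !inE => /eqP-> /eqP->.
rewrite inE Br; apply/forallP => i; apply/negP => /subsetP Bi.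
by move: (Bi _ uB) (Bi _ wB) neq_wu; rewrite !inE => /eqP-> ->.
Qed.

Lemma card_color_classes (T C : finType) (c : T -> C) (A : {set T}) :
  #|A| = \sum_x #|A :&: [set v | c v == x]|.
Proof.
rewrite -sum1_card (partition_big c predT) //=.
by apply: eq_bigr => x _; rewrite -sum1_card; apply: eq_bigl => v; rewrite !inE.
Qed.

Lemma card_balanced_vertex (k m : nat) : #|vertex (fun _ : 'I_k => m)| = k * m.
Proof.
rewrite card_tagged sumnE big_map big_enum /=.
by rewrite (eq_bigr (fun=> m)) => [|i _]; rewrite ?sum_nat_const card_ord.
Qed.

Lemma card_part (k : nat) (p : 'I_k -> nat) (i : 'I_k) : #|part p i| = p i.
Proof.
have inj_Tag : injective (fun j : 'I_(p i) => Tagged (fun i => 'I_(p i)) j).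
  by move=> a b /eqP; rewrite eq_Tagged => /eqP.
rewrite -[RHS]card_ord -(card_imset _ inj_Tag); apply: eq_card => v.
rewrite inE; apply/eqP/imsetP => [|[j _ ->] //].
by case: v => i' j /= <- {inj_Tag}; exists j.
Qed.

Lemma injective_not_monochromatic (T : finType) (C : Type) (c : T -> C)
    (e : {set T}) :
  injective c -> 1 < #|e| -> ~ monochromatic c e.
Proof.
by move=> injc /card_gt1P[u [v [ue ve /eqP neq]]] /(_ u v ue ve) /injc.
Qed.

(** Ensures that the minimum defining the list chromatic number is attained, not the default 0. With
    lists as large as the vertex set, a greedy choice gives all vertices distinct colors. *)
Lemma choosable_card (T : finType) (H : hypergraph T) :
  (forall e, e \in H -> 1 < #|e|) -> choosable H #|T|.
Proof.
move=> He C L Lcard.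
have greedy (s : seq T) : uniq s -> exists c : T -> C,
    (forall v, c v \in L v) /\ {in s &, injective c}.
  elim: s => [_|v s IHs /= /andP[vs us]].
    (* The coloring must be total even when [s] is empty; [v] itself witnesses that [#|T|], the size
       of its list, is positive. *)
    have Lne v : exists x, x \in L v.
      by apply/fset0Pn; rewrite -cardfs_gt0 Lcard; apply/card_gt0P; exists v.
    by exists (fun v => xchoose (Lne v)); split=> // v; apply: xchooseP.
  have [c [cL injc]] := IHs us.
  have [x xL xs] : exists2 x, x \in L v & x \notin map c s.
    apply/hasP; apply: contraT => /hasPn Ls.
    have : size (L v) <= size (map c s).
      by apply: uniq_leq_size (fset_uniq _) _ => x /Ls /negPn.
    rewrite Lcard size_map leqNgt (@leq_trans (size (v :: s))) //.
    by rewrite -(card_uniqP (_ : uniq (v :: s))) ?max_card //= vs.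
  exists (fun w => if w == v then x else c w); split=> [w|a b].
    by case: eqP => [->|].
  rewrite !inE; case: eqVneq => [->|_]; case: eqVneq => [->|_] //= a_s b_s.
  - by move=> xE; case/negP: xs; rewrite xE map_f.
  - by move=> xE; case/negP: xs; rewrite -xE map_f.
  - exact: injc.
have [c [cL injc]] := greedy _ (enum_uniq T).
exists c; split=> // e eH; apply: injective_not_monochromatic => [u v|].
  by apply: injc; rewrite mem_enum.
exact: He.
Qed.

(** Give every vertex the same list, all of ['I_k]. *)
Lemma choosable_colorable (T : finType) (H : hypergraph T) k :
  choosable H k -> colorable H k.
Proof.
move=> /(_ 'I_k (fun=> [fset x in enum 'I_k]%fset)) [v|c [_ propc]].
  by rewrite card_fseq undup_id ?enum_uniq // size_enum_ord.
by exists c.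
Qed.

Lemma complete_multipartite_colorable (r k : nat) (p : 'I_k -> nat) :
  0 < r -> colorable (complete_multipartite r p) k.
Proof.
move=> r_gt0; exists (fun v => tag v) => e.
rewrite inE => /andP[/eqP er /forallP e_part] mono.
have /card_gt0P[u ue] : 0 < #|e| by rewrite er.
by case/negP: (e_part (tag u)); apply/subsetP => v ve; rewrite inE (mono v u).
Qed.

Lemma balanced_colorable_geq (r k n : nat) :
  1 < r -> colorable (balanced_multipartite r r.+1 k) n -> k <= n.
Proof.
(* Compare [k * r.+1], the number of vertices, with [n] classes of at most [r.+1] vertices each: a
   class has fewer than [r] vertices or lies in a part. *)
move=> r_gt1 [c propc]; rewrite -(@leq_pmul2r r.+1) //.
rewrite -card_balanced_vertex -cardsT (card_color_classes c).
have -> : n * r.+1 = \sum_(x < n) r.+1 by rewrite sum_nat_const card_ord.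
apply: leq_sum => x _; rewrite setTI.
case: (leqP r #|[set v | c v == x]|) => [leS|/ltnW/leqW //].
have [i /subset_leq_card] := color_class_sub_part r_gt1 propc leS.
by rewrite card_part.
Qed.

Lemma balanced_not_choosable (r : nat) :
  1 < r -> ~ choosable (balanced_multipartite r r.+1 r) r.
Proof.
move=> r_gt1 chs; pose V := vertex (fun _ : 'I_r => r.+1).
(* Positions within a part and colors share the type ['I_r.+1]. *)
pose L (v : V) := [fset x in enum [set~ (tagged v : 'I_r.+1)]]%fset.
have [v|c [cL propc]] := chs _ L.
  by rewrite card_fseq undup_id ?enum_uniq // -cardE cardsC1 card_ord.
have c_neq v : c v != tagged v.
  by have := cL v; rewrite in_fset /= mem_enum !inE.
pose S x := [set v | c v == x].
have S_small x i : S x \subset part _ i -> #|S x| <= r.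
  move=> Si; suff /proper_card : S x \proper part _ i by rewrite card_part ltnS.
  rewrite properE Si; apply/subsetPn.
  (* The vertex at position [x] of part [i] has no [x] in its list, so the inclusion is strict. *)
  pose w : V := @Tagged _ i (fun=> 'I_r.+1) x.
  by exists w; rewrite inE //=; apply: (c_neq w).
have S_leq x : #|S x| <= r.
  case: (leqP r #|S x|) => [leS|/ltnW //].
  by have [i /S_small] := color_class_sub_part r_gt1 propc leS.
have S_eq x : #|S x| = r.
  apply/eqP; move: x; apply/forallP.
  (* Equality of the sums forces equality in every term: the [r.+1] classes, each of size at most
     [r], cover all [r * r.+1] vertices. *)
  have := leqif_sum (fun x (_ : predT x) => leqif_eq (S_leq x)) => -[_ <-].
  rewrite sum_nat_const card_ord mulnC -card_balanced_vertex -cardsT.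
  by rewrite (card_color_classes c); apply/eqP/eq_bigr => x _; rewrite setTI.
pose i0 := Ordinal (ltnW r_gt1).
(* Each class meets the part [i0] in [r] vertices or in none, so [r] divides the size of that
   part. *)
have: r %| r.+1.
  rewrite -[X in _ %| X](card_part (fun _ : 'I_r => r.+1) i0).
  rewrite (card_color_classes c); apply: dvdn_sum => x _; rewrite -/(S x).
  have [i Si] := color_class_sub_part r_gt1 propc (eq_leq (esym (S_eq x))).
  have [eq_i|neq_i] := eqVneq i i0.
    by rewrite -eq_i (setIidPr Si) S_eq.
  suff -> : part _ i0 :&: S x = set0 by rewrite cards0.
  apply/setP => v; rewrite in_setI in_set0; apply/negP => /andP[v0].
  move=> /(subsetP Si); move: v0 neq_i; rewrite !inE => /eqP-> neq_i.
  by rewrite eq_sym (negPf neq_i).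
by rewrite -addn1 dvdn_addr // dvdn1 (gtn_eqF r_gt1).
Qed.

Theorem theorem3p2 (r : nat) (hr : 2 <= r) :
  list_chromatic_number (balanced_multipartite r r.+1 r)
    > chromatic_number (balanced_multipartite r r.+1 r) /\
  chromatic_number (balanced_multipartite r r.+1 r) = r.
Proof.
set H := balanced_multipartite r r.+1 r.
have colr : colorable H r by apply/complete_multipartite_colorable/ltnW.
have chiE : chromatic_number H = r.
  apply/eqP; rewrite eqn_leq least_leq //=.
  by apply: (balanced_colorable_geq hr); apply: leastP; exists r.
rewrite chiE; split=> //.
have chs : choosable H (list_chromatic_number H).
  apply: leastP; eexists; apply: choosable_card => e.
  by rewrite inE => /andP[/eqP-> _].
(* Choosability implies colorability, which gives the weak inequality; only equality remains to be
   excluded. *)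
rewrite ltn_neqAle (balanced_colorable_geq hr (choosable_colorable chs)) andbT.
by apply/eqP => r_eq; apply: (balanced_not_choosable hr); rewrite -r_eq in chs.
Qed.
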